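(* Let $(A,\wedge)$ be a graded associative algebra over $\mathbb{C}$, and let $\mathrm{d}:A\to A$ be an odd degree super derivation of $\wedge$ with $\mathrm{d}^2=0$. Then the formula $$a_1\wedge^{\mathrm{d}}a_2=a_1\wedge a_2+\mathrm{i}\hbar(-1)^{|a_1|}\,\mathrm{d}a_1\wedge \mathrm{d}a_2$$ (for homogeneous $a_1,a_2\in A$, extended $\mathbb{C}[[\hbar]]$-bilinearly to formal power series) defines a deformed associative product on $A[[\hbar]]$; that is, $\wedge^{\mathrm{d}}$ is associative on $A[[\hbar]]$ and reduces to $\wedge$ at $\hbar=0$.
   Context: Here $\mathrm{i}=\sqrt{-1}$, $\hbar$ is a formal parameter, $A[[\hbar]]$ denotes formal power series in $\hbar$ with coefficients in $A$, and $|a|$ is the degree of a homogeneous element $a$. Extending $\mathbb{C}[[\hbar]]$-bilinearly means: bilinearly in $A$ and then coefficientwise (with the Cauchy product rule in $\hbar$) to power series. An odd degree super derivation of $\wedge$ is a $\mathbb{C}$-linear map $\mathrm{d}:A\to A$, homogeneous of odd degree, satisfying the graded Leibniz rule $\mathrm{d}(a_1\wedge a_2)=\mathrm{d}a_1\wedge a_2+(-1)^{|a_1|}a_1\wedge \mathrm{d}a_2$ for homogeneous $a_1,a_2$. *)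

(* Defs.v *)
From HB Require Import structures.
From mathcomp Require Import all_boot all_order all_algebra.
From mathcomp Require Import complex sesquilinear.
From mathcomp Require Import boolp classical_sets functions cardinality fsbigop.
From mathcomp Require Import reals.

Set Implicit Arguments.
Unset Strict Implicit.
Unset Printing Implicit Defensive.

Import Order.TTheory GRing.Theory Num.Theory.
Local Open Scope classical_set_scope.
Local Open Scope ring_scope.
Local Open Scope complex_scope.

(* Formal power series in hbar: f n is the coefficient of hbar ^ n. The additive
   structure is the pointwise one on functions. *)
Notation "V '[[hbar]]'" := (nat -> V) (at level 2, only parsing) : type_scope.

Section FormalPowerSeries.
Context {K : nzRingType} {V : lmodType K}.

(* v * hbar ^ n *)
Definition fps_monomial (n : nat) (v : V) : V[[hbar]] :=
  fun m => if m == n then v else 0.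

Definition fps_scale (c : K[[hbar]]) (f : V[[hbar]]) : V[[hbar]] :=
  fun n => \sum_(i < n.+1) c i *: f (n - i)%N.

Definition fps_bilinear (star : V[[hbar]] -> V[[hbar]] -> V[[hbar]]) : Prop :=
  (forall c f g h, star (fps_scale c f + g) h = fps_scale c (star f h) + star g h) /\
  (forall c f g h, star h (fps_scale c f + g) = fps_scale c (star h f) + star h g).

(* Coefficientwise extension of B : V -> V -> V[[hbar]]: the coefficient of
   hbar ^ n collects the terms B (f i) (g j) * hbar ^ (i + j) with i + j <= n. *)
Definition cauchy_extension (B : V -> V -> V[[hbar]]) (f g : V[[hbar]]) :
    V[[hbar]] :=
  fun n => \sum_(i < n.+1) \sum_(j < (n - i).+1) B (f i) (g j) (n - i - j)%N.

End FormalPowerSeries.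

Section Graded.
Context {K : unitRingType} {A : lmodType K}.
Implicit Types (gr : int -> set A) (wedge : A -> A -> A).

Definition homogeneous_decomposition gr (a : A) (c : int -> A) : Prop :=
  [/\ forall k, gr k (c k), finite_set [set k | c k != 0]
    & a = \sum_(k \in [set: int]) c k].

(* A is the internal direct sum of the submodules gr k, k in Z. *)
Definition is_grading gr : Prop :=
  (forall k, gr k 0 /\
     forall (x : K) a b, gr k a -> gr k b -> gr k (x *: a + b)) /\
  (forall a, exists! c, homogeneous_decomposition gr a c).

(* Bilinearity of wedge, and linearity of d below, are carried by the types
   {bilinear A -> A -> A} and {linear A -> A} at use sites. No unit is required. *)
Definition is_graded_algebra gr wedge : Prop :=
  [/\ is_grading gr, associative wedge
    & forall k l a b, gr k a -> gr l b -> gr (k + l) (wedge a b)].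

Definition is_odd_superderivation gr wedge (d : A -> A) : Prop :=
  (exists2 p : int, odd `|p|%N & forall k a, gr k a -> gr (k + p) (d a)) /\
  (forall k l a b, gr k a -> gr l b ->
     d (wedge a b) = wedge (d a) b + (-1) ^ k *: wedge a (d b)).

(* The homogeneous components of a; xget picks the decomposition, which exists
   and is unique when gr is a grading. *)
Definition component gr (a : A) : int -> A :=
  xget (fun=> 0) [set c | homogeneous_decomposition gr a c].

(* Extension to all of A of a map F k l a b given for a, b homogeneous of
   degrees k, l. *)
Definition extend_homogeneous {W : zmodType} gr
    (F : int -> int -> A -> A -> W) (a b : A) : W :=
  \sum_(k \in [set: int]) \sum_(l \in [set: int])
    F k l (component gr a k) (component gr b l).

End Graded.

Section DeformedProduct.
Context {R : realType} {A : lmodType R[i]}.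

(* The defining formula for a1, a2 homogeneous of degrees k = |a1|, l = |a2|. *)
Definition deformed_formula (wedge : A -> A -> A) (d : A -> A) (k l : int)
    (a1 a2 : A) : A[[hbar]] :=
  fps_monomial 0 (wedge a1 a2)
  + fps_monomial 1 (('i%C * (-1) ^ k) *: wedge (d a1) (d a2)).

Definition deformed_product (gr : int -> set A) (wedge : A -> A -> A)
    (d : A -> A) : A[[hbar]] -> A[[hbar]] -> A[[hbar]] :=
  cauchy_extension (extend_homogeneous gr (deformed_formula wedge d)).

End DeformedProduct.

(* Main.v *)
Require Import Defs.
From mathcomp Require Import all_boot all_order all_algebra.
From mathcomp Require Import complex sesquilinear classical_sets functions reals.
From mathcomp Require Import finmap boolp cardinality fsbigop.

(** Let tau be the parity involution, the linear map equal to (-1)^k on the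
    component of degree k. In terms of tau the signs disappear from the
    problem: the deformed product is, for arbitrary a and b,

      a * b = a b + hbar n(a, b),    n(a, b) = i (d tau a) (d b),

    the Leibniz rule reads d(a b) = (d a) b + (tau a)(d b), tau is
    an algebra endomorphism with tau^2 = 1, and d tau = - tau d because d is odd.
    Associativity then splits by powers of hbar:

    - order 0 is the associativity of the original product;
    - order 1 is the cocycle identity a n(b, c) + n(a, b c) = n(a, b) c + n(a b, c),
      in which both sides expand to i times
      a (d tau b)(d c) + (d tau a)(d b) c + (d tau a)(tau b)(d c)
      ([correction_cocycle]);
    - order 2 compares n(a, n(b, c)) with n(n(a, b), c), and both vanish, since
      each contains d, possibly composed with tau, applied to a product of
      d-closed elements ([correction_nest]).

    The passage from these identities on A to power series is independent of
    where n comes from ([two_term_deformation_assoc]): a product a b + hbar n(a, b)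
    extends to series as the Cauchy convolution for the original product plus
    the shifted Cauchy convolution for n. *)

Set Implicit Arguments.
Unset Strict Implicit.
Unset Printing Implicit Defensive.

Import GRing.Theory.
Local Open Scope classical_set_scope.
Local Open Scope ring_scope.
Local Open Scope complex_scope.

(** * Biadditive maps *)

(** Additivity alone governs the manipulation of sums, and it makes sense both
    for products on A and for the scalar action, whose arguments have different
    types. *)
Definition biadditive {U V W : zmodType} (m : U -> V -> W) : Prop :=
  (forall v, {morph m^~ v : x y / x + y}) /\ (forall u, {morph m u : x y / x + y}).

Section Biadditive.
Context {U V W : zmodType} (m : U -> V -> W) (hm : biadditive m).

Lemma biadditive0l v : m 0 v = 0.
Proof. by apply: (addrI (m 0 v)); rewrite -(hm.1 v) !addr0. Qed.

Lemma biadditive0r u : m u 0 = 0.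
Proof. by apply: (addrI (m u 0)); rewrite -(hm.2 u) !addr0. Qed.

Lemma biadditive_suml I (r : seq I) (F : I -> U) v :
  m (\sum_(i <- r) F i) v = \sum_(i <- r) m (F i) v.
Proof. exact: (big_morph (m^~ v) (hm.1 v) (biadditive0l v)). Qed.

Lemma biadditive_sumr I (r : seq I) (F : I -> V) u :
  m u (\sum_(i <- r) F i) = \sum_(i <- r) m u (F i).
Proof. exact: (big_morph (m u) (hm.2 u) (biadditive0r u)). Qed.

Lemma biadditive_flip : biadditive (fun v u => m u v).
Proof. by case: hm. Qed.

End Biadditive.

(** * Cauchy convolution of sequences *)

Definition conv {U V W : zmodType} (m : U -> V -> W) (f : nat -> U) (g : nat -> V) :
    nat -> W :=
  fun n => \sum_(i < n.+1) m (f i) (g (n - i)%N).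

(** The common normal form of both ways of nesting two convolutions. *)
Definition conv3 {U V W X : zmodType} (T : U -> V -> W -> X)
    (f : nat -> U) (g : nat -> V) (h : nat -> W) : nat -> X :=
  fun n => \sum_(i < n.+1) \sum_(j < (n - i).+1) T (f i) (g j) (h (n - i - j)%N).

(** Multiplication by hbar. *)
Definition shift {V : zmodType} (f : nat -> V) : nat -> V :=
  fun n => if n is n'.+1 then f n' else 0.

(** Both sides run over the triples of sum n; peeling off the terms whose first
    index is 0 leaves the same identity for n - 1. *)
Lemma exchange_triangle (W : zmodType) (F : nat -> nat -> nat -> W) n :
  \sum_(i < n.+1) \sum_(j < i.+1) F j (i - j)%N (n - i)%N =
  \sum_(j < n.+1) \sum_(i < (n - j).+1) F j i (n - j - i)%N.
Proof.
elim: n F => [|n IHn] F; first by rewrite !big_ord1.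
under eq_bigr => i _ do rewrite big_ord_recl /= subn0.
rewrite big_split [in RHS]big_ord_recl /= subn0; congr (_ + _).
rewrite big_ord_recl big_ord0 add0r.
exact: (IHn (fun j => F j.+1)).
Qed.

(** Reduces every statement about the right argument of a convolution to the one
    about the left argument. *)
Lemma conv_flip (U V W : zmodType) (m : U -> V -> W) f g :
  conv m f g = conv (fun v u => m u v) g f.
Proof.
apply/funext => n; rewrite /conv (reindex_inj rev_ord_inj) /=.
by apply: eq_bigr => i _; rewrite subSS subKn // -ltnS.
Qed.

Lemma convDl (U V W : zmodType) (m : U -> V -> W) f f' g : biadditive m ->
  conv m (f + f') g = conv m f g + conv m f' g.
Proof.
by move=> hm; apply/funext => n; rewrite !addrfctE /conv /= -big_split;
apply: eq_bigr => i _; exact: hm.1.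
Qed.

Lemma convDr (U V W : zmodType) (m : U -> V -> W) f g g' : biadditive m ->
  conv m f (g + g') = conv m f g + conv m f g'.
Proof.
by move=> hm; rewrite !(conv_flip m) convDl //; exact: biadditive_flip.
Qed.

Lemma conv_shiftl (U V W : zmodType) (m : U -> V -> W) f g :
  biadditive m -> conv m (shift f) g = shift (conv m f g).
Proof.
move=> hm; apply/funext => -[|n]; first by rewrite /conv big_ord1 biadditive0l.
by rewrite /conv big_ord_recl biadditive0l // add0r.
Qed.

Lemma conv_shiftr (U V W : zmodType) (m : U -> V -> W) f g :
  biadditive m -> conv m f (shift g) = shift (conv m f g).
Proof.
by move=> hm; rewrite !(conv_flip m) conv_shiftl //; exact: biadditive_flip.
Qed.

Lemma conv_monomial0 {K : nzRingType} {A B C : lmodType K} (m : A -> B -> C) a b :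
  biadditive m ->
  conv m (fps_monomial 0 a) (fps_monomial 0 b) = fps_monomial 0 (m a b).
Proof.
move=> hm; apply/funext => n; rewrite /conv big_ord_recl big1 ?addr0 => [|i _].
  by case: n => [|n] /=; rewrite ?(biadditive0r hm).
exact: biadditive0l.
Qed.

Lemma conv_convl (U V W X Y : zmodType) (m1 : X -> W -> Y) (m2 : U -> V -> X) f g h :
  biadditive m1 ->
  conv m1 (conv m2 f g) h = conv3 (fun a b c => m1 (m2 a b) c) f g h.
Proof.
move=> hm; apply/funext => n; rewrite /conv /conv3.
under eq_bigr => i _ do rewrite biadditive_suml //.
exact: (exchange_triangle (fun i j k => m1 (m2 (f i) (g j)) (h k))).
Qed.

Lemma conv_convr (U V W X Y : zmodType) (m1 : U -> X -> Y) (m2 : V -> W -> X) f g h :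
  biadditive m1 ->
  conv m1 f (conv m2 g h) = conv3 (fun a b c => m1 a (m2 b c)) f g h.
Proof.
by move=> hm; apply/funext => n; apply: eq_bigr => i _; rewrite biadditive_sumr.
Qed.

Lemma eq_conv3 (U V W X : zmodType) (T T' : U -> V -> W -> X) f g h :
  (forall a b c, T a b c = T' a b c) -> conv3 T f g h = conv3 T' f g h.
Proof. by move=> eqT; congr conv3; do 3!apply/funext => ?. Qed.

Lemma conv3D (U V W X : zmodType) (T T' : U -> V -> W -> X) f g h :
  conv3 T f g h + conv3 T' f g h = conv3 (fun a b c => T a b c + T' a b c) f g h.
Proof.
apply/funext => n; rewrite /conv3 !addrfctE /= -big_split.
by apply: eq_bigr => i _; rewrite -big_split.
Qed.

Lemma shiftD (V : zmodType) (f g : nat -> V) : shift (f + g) = shift f + shift g.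
Proof. by apply/funext => -[|n] //=; rewrite !addrfctE addr0. Qed.

(** The last three hypotheses say that the coefficients of hbar^0, hbar^1 and hbar^2
    in the associator of m + hbar n vanish; there are no higher ones. *)
Lemma two_term_deformation_assoc (A : zmodType) (m n : A -> A -> A) :
    biadditive m -> biadditive n -> associative m ->
    (forall a b c, m a (n b c) + n a (m b c) = m (n a b) c + n (m a b) c) ->
    (forall a b c, n a (n b c) = n (n a b) c) ->
  associative (fun f g => conv m f g + shift (conv n f g)).
Proof.
move=> hm hn mA mnA nA f g h.
rewrite !(convDl _ _ _ hm) !(convDl _ _ _ hn) !(convDr _ _ _ hm) !(convDr _ _ _ hn).
rewrite !conv_shiftl // !conv_shiftr // !shiftD.
rewrite !conv_convl // !conv_convr // !addrA.
(* Bring the two terms of order 1 on each side together under one shift. *)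
rewrite -[X in X + _ = _]addrA -[X in _ = X + _]addrA -!shiftD !conv3D.
by congr (_ + shift _ + shift (shift _)); exact: eq_conv3.
Qed.

Section Scaling.
Context {K : nzRingType} {V : lmodType K}.

(** The action of scalar series is itself a convolution, so that bilinearity over
    series is an instance of the reassociation of nested convolutions. *)
Lemma biadditive_scale : biadditive ( *:%R : K -> V -> V).
Proof. by split=> [v x y|x u v]; rewrite ?scalerDl ?scalerDr. Qed.

Lemma fps_scaleE (c : K[[hbar]]) (f : V[[hbar]]) : fps_scale c f = conv *:%R c f.
Proof. by []. Qed.

Context (m : V -> V -> V) (hm : biadditive m).

Lemma conv_scalel c f g : (forall x u v, m (x *: u) v = x *: m u v) ->
  conv m (fps_scale c f) g = fps_scale c (conv m f g).
Proof.
move=> mZ; rewrite !fps_scaleE conv_convl // (conv_convr _ _ _ _ biadditive_scale).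
exact: eq_conv3.
Qed.

Lemma shift_scale c (f : V[[hbar]]) : shift (fps_scale c f) = fps_scale c (shift f).
Proof. by rewrite !fps_scaleE conv_shiftr //; exact: biadditive_scale. Qed.

End Scaling.

Lemma conv_scaler (K : nzRingType) (V : lmodType K) (m : V -> V -> V) c f g :
  biadditive m -> (forall x u v, m u (x *: v) = x *: m u v) ->
  conv m f (fps_scale c g) = fps_scale c (conv m f g).
Proof.
by move=> hm mZ; rewrite !(conv_flip m) conv_scalel //; exact: biadditive_flip.
Qed.

Definition scale_biequivariant {K : nzRingType} {V : lmodType K} (m : V -> V -> V) :=
  (forall x u v, m (x *: u) v = x *: m u v) /\ (forall x u v, m u (x *: v) = x *: m u v).

Lemma two_term_deformation_bilinear (K : nzRingType) (A : lmodType K)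
    (m n : A -> A -> A) :
    biadditive m -> scale_biequivariant m ->
    biadditive n -> scale_biequivariant n ->
  fps_bilinear (fun f g => conv m f g + shift (conv n f g)).
Proof.
move=> hm [mZl mZr] hn [nZl nZr].
have scaleD c (f g : A[[hbar]]) : fps_scale c (f + g) = fps_scale c f + fps_scale c g.
  exact: (convDr _ _ _ biadditive_scale).
split=> c f g h.
  rewrite (convDl _ _ _ hm) (convDl _ _ _ hn) !conv_scalel // shiftD shift_scale.
  by rewrite scaleD addrACA.
rewrite (convDr _ _ _ hm) (convDr _ _ _ hn) !conv_scaler // shiftD shift_scale.
by rewrite scaleD addrACA.
Qed.

(** * Coefficientwise extension as a convolution *)

Section CauchyExtension.
Context {K : nzRingType} {V : lmodType K}.

Lemma cauchy_extensionD (B B' : V -> V -> V[[hbar]]) f g :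
  cauchy_extension (fun a b => B a b + B' a b) f g =
  cauchy_extension B f g + cauchy_extension B' f g.
Proof.
apply/funext => n; rewrite /cauchy_extension !addrfctE /= -big_split.
by apply: eq_bigr => i _; rewrite -big_split.
Qed.

Lemma cauchy_extension_monomial0 (m : V -> V -> V) f g :
  cauchy_extension (fun a b => fps_monomial 0 (m a b)) f g = conv m f g.
Proof.
apply/funext => n; apply: eq_bigr => i _; rewrite big_ord_recr /= subnn big1 ?add0r //.
by move=> j _; rewrite /fps_monomial subn_eq0 leqNgt ltn_ord.
Qed.

(** In degree n + 1 the only pairs (i, j) absent in degree n are those with
    i + j = n + 1, which meet the constant coefficient 0 of the monomial. *)
Lemma cauchy_extension_monomialS k (m : V -> V -> V) f g :
  cauchy_extension (fun a b => fps_monomial k.+1 (m a b)) f g =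
  shift (cauchy_extension (fun a b => fps_monomial k (m a b)) f g).
Proof.
apply/funext => -[|n]; first by rewrite /cauchy_extension !big_ord1.
rewrite /cauchy_extension big_ord_recr /= subnn big_ord1 addr0.
apply: eq_bigr => i _; rewrite subSn -1?ltnS // big_ord_recr /= subnn addr0.
by apply: eq_bigr => j _; rewrite subSn -1?ltnS.
Qed.

End CauchyExtension.

(** * Graded modules and the parity involution *)

Section Grading.
Context {K : comUnitRingType} {A : lmodType K} (gr : int -> set A).
Hypothesis grA : is_grading gr.

Lemma componentP a : homogeneous_decomposition gr a (component gr a).
Proof. by have [c [hc _]] := grA.2 a; exact: (xgetI _ hc). Qed.

Lemma component_unique a c : homogeneous_decomposition gr a c -> component gr a = c.
Proof.
move=> hc; have [c' [_ c'_unique]] := grA.2 a.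
by rewrite -(c'_unique _ hc); apply/esym/c'_unique/componentP.
Qed.

(** Finitely supported sums over all integers are turned into sums over finite
    sets containing such supports, where several elements can be treated at once. *)
Definition degrees a : {fset int} := fset_set [set k | component gr a k != 0].

Lemma notin_degrees a k : k \notin degrees a -> component gr a k = 0.
Proof.
have [_ fin_a _] := componentP a.
by rewrite in_fset_set // notin_setE /= => /negP/negPn/eqP.
Qed.

Lemma sum_component (s : {fset int}) a : {subset degrees a <= s} ->
  \sum_(k <- s) component gr a k = a.
Proof.
move=> sub; have [_ _ {2}->] := componentP a; rewrite (fsbigTE s) // => k ks.
by apply: notin_degrees; apply: contra ks; exact: sub.
Qed.

(** Linear combinations of decompositions are decompositions, so uniqueness of
    the decomposition makes the projections to the components linear. *)
Lemma component_linear x a b k :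
  component gr (x *: a + b) k = x *: component gr a k + component gr b k.
Proof.
suff -> : component gr (x *: a + b) =
          (fun k => x *: component gr a k + component gr b k) by [].
have [hom_a fin_a eq_a] := componentP a; have [hom_b fin_b eq_b] := componentP b.
apply: component_unique; split.
- by move=> j; apply: (grA.1 j).2.
- apply: (@sub_finite_set _ _
      ([set k | component gr a k != 0] `|` [set k | component gr b k != 0])).
  2: by rewrite finite_setU.
  move=> j /=.
  case: (eqVneq (component gr a j) 0) => [->|]; last by left.
  by rewrite scaler0 add0r; right.
rewrite (fsbigTE (degrees a `|` degrees b)%fset); last first.
  move=> j; rewrite in_fsetU negb_or => /andP[/notin_degrees-> /notin_degrees->].
  by rewrite scaler0 addr0.
rewrite big_split -scaler_sumr /= !sum_component // => j jI; rewrite in_fsetU jI ?orbT //.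
Qed.

Lemma component_homogeneous k a : gr k a ->
  component gr a = fun j => if j == k then a else 0.
Proof.
move=> hom_a; apply: component_unique; split.
- by move=> j; case: eqP => [->|_] //; exact: (grA.1 j).1.
- apply: (@sub_finite_set _ _ [set k]); last exact: finite_set1.
  by move=> j /=; case: ifP => [/eqP->|]; rewrite ?eqxx.
rewrite (fsbigTE [fset k]%fset) => [|j]; first by rewrite big_seq_fset1 eqxx.
by rewrite in_fset1 => /negbTE->.
Qed.

Lemma homogeneous_ind (P : A -> Prop) :
    P 0 -> (forall a b, P a -> P b -> P (a + b)) -> (forall k a, gr k a -> P a) ->
  forall a, P a.
Proof.
move=> P0 PD Phom a; rewrite -(@sum_component (degrees a) a) //.
by apply: big_ind => // k _; apply: (Phom k); have [] := componentP a.
Qed.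

(** The tool by which formulas for homogeneous elements are carried over to all
    of A, one argument at a time. *)
Lemma eq_on_homogeneous (U : zmodType) (f g : A -> U) :
    {morph f : x y / x + y} -> {morph g : x y / x + y} ->
    (forall k a, gr k a -> f a = g a) -> f =1 g.
Proof.
move=> fD gD fg a; elim/homogeneous_ind: a => [|a b IHa IHb|k a]; last exact: fg.
  exact: fg (grA.1 0).1.
by rewrite fD gD IHa IHb.
Qed.

Section Extension.
Context {W : zmodType} (F : int -> int -> A -> A -> W).
Hypothesis F_biadditive : forall k l, biadditive (F k l).

Lemma extend_homogeneousE (s t : {fset int}) a b :
    {subset degrees a <= s} -> {subset degrees b <= t} ->
  extend_homogeneous gr F a b =
  \sum_(k <- s) \sum_(l <- t) F k l (component gr a k) (component gr b l).
Proof.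
move=> sub_a sub_b; rewrite /extend_homogeneous (fsbigTE s) => [|k ks].
  apply: eq_bigr => k _; rewrite (fsbigTE t) // => l lt.
  rewrite (notin_degrees (a := b)) ?(biadditive0r (F_biadditive _ _)) //.
  by apply: contra lt; exact: sub_b.
rewrite fsbig1 // => l _; rewrite (notin_degrees (a := a)).
  by rewrite (biadditive0l (F_biadditive _ _)).
by apply: contra ks; exact: sub_a.
Qed.

Lemma extend_homogeneous_biadditive : biadditive (extend_homogeneous gr F).
Proof.
have compD a b k : component gr (a + b) k = component gr a k + component gr b k.
  by rewrite -{1}(scale1r a) component_linear scale1r.
split=> [v x y|u x y].
  pose s := (degrees x `|` degrees y `|` degrees (x + y))%fset.
  rewrite !(@extend_homogeneousE s (degrees v)) //;
    try by move=> k; rewrite !in_fsetU => ->; rewrite ?orbT.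
  rewrite -big_split; apply: eq_bigr => k _; rewrite -big_split; apply: eq_bigr => l _.
  by rewrite compD (F_biadditive k l).1.
pose s := (degrees x `|` degrees y `|` degrees (x + y))%fset.
rewrite !(@extend_homogeneousE (degrees u) s) //;
  try by move=> k; rewrite !in_fsetU => ->; rewrite ?orbT.
rewrite -big_split; apply: eq_bigr => k _; rewrite -big_split; apply: eq_bigr => l _.
by rewrite compD (F_biadditive k l).2.
Qed.

Lemma extend_homogeneous_homogeneous k l a b : gr k a -> gr l b ->
  extend_homogeneous gr F a b = F k l a b.
Proof.
move=> hom_a hom_b.
have sub j c : gr j c -> {subset degrees c <= [fset j]%fset}.
  move=> hom_c i; apply: contraLR => ij; rewrite in_fset_set; last by have [] := componentP c.
  rewrite notin_setE /= (component_homogeneous hom_c).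
  by move: ij; rewrite in_fset1 => /negbTE->; rewrite eqxx.
rewrite (extend_homogeneousE (sub _ _ hom_a) (sub _ _ hom_b)) !big_seq_fset1.
by rewrite (component_homogeneous hom_a) (component_homogeneous hom_b) !eqxx.
Qed.

End Extension.

Definition parity (a : A) : A := \sum_(k \in [set: int]) (-1) ^ k *: component gr a k.

Lemma parityE (s : {fset int}) a : {subset degrees a <= s} ->
  parity a = \sum_(k <- s) (-1) ^ k *: component gr a k.
Proof.
move=> sub; rewrite /parity (fsbigTE s) // => k ks.
by rewrite notin_degrees ?scaler0 //; apply: contra ks; exact: sub.
Qed.

Lemma parity_linear x a b : parity (x *: a + b) = x *: parity a + parity b.
Proof.
pose s := (degrees a `|` degrees b `|` degrees (x *: a + b))%fset.
rewrite !(@parityE s); try by move=> k; rewrite !in_fsetU => ->; rewrite ?orbT.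
rewrite scaler_sumr -big_split; apply: eq_bigr => k _ /=.
by rewrite component_linear scalerDr !scalerA mulrC.
Qed.

Lemma parityD : {morph parity : a b / a + b}.
Proof. by move=> a b; rewrite -{1}(scale1r a) parity_linear scale1r. Qed.

Lemma parity0 : parity 0 = 0.
Proof. by apply: (addrI (parity 0)); rewrite -parityD !addr0. Qed.

Lemma parityZ x a : parity (x *: a) = x *: parity a.
Proof. by rewrite -[x *: a]addr0 parity_linear parity0 addr0. Qed.

Lemma parity_homogeneous k a : gr k a -> parity a = (-1) ^ k *: a.
Proof.
move=> hom_a; rewrite /parity (component_homogeneous hom_a) (fsbigTE [fset k]%fset).
  by rewrite big_seq_fset1 eqxx.
by move=> j; rewrite in_fset1 => /negbTE->; rewrite scaler0.
Qed.

End Grading.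

(** * Signs *)

Section Sign.
Context {K : unitRingType}.
Implicit Types k p : int.

Lemma mul_sign k : (-1) ^ k * (-1) ^ k = 1 :> K.
Proof. by rewrite -exprMz_comm ?unitrN1 // mulrNN mulr1 exp1rz. Qed.

Lemma sign_odd p : odd `|p|%N -> (-1) ^ p = -1 :> K.
Proof.
case: p => n /= odd_n; rewrite /exprz -signr_odd /= odd_n expr1 //.
by rewrite invrN1.
Qed.

End Sign.

(** * The first-order term of the deformed product *)

Section SuperDerivation.
Context {K : comUnitRingType} {A : lmodType K} (gr : int -> set A).
Context (wedge : {bilinear A -> A -> A}) (d : {linear A -> A}).
Hypothesis hA : is_graded_algebra gr wedge.
Hypothesis hd : is_odd_superderivation gr wedge d.
Hypothesis hd2 : forall a, d (d a) = 0.

Let grA : is_grading gr. Proof. by case: hA. Qed.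
Local Notation tau := (parity gr).

Lemma parityK : involutive tau.
Proof.
apply: (eq_on_homogeneous grA (f := tau \o tau)) => // [a b|k a hom_a] /=.
  by rewrite !parityD.
by rewrite (parity_homogeneous grA hom_a) parityZ // (parity_homogeneous grA hom_a)
  scalerA mul_sign scale1r.
Qed.

(** The degree of d is odd, so d maps even components to odd ones and vice versa. *)
Lemma d_parity a : d (tau a) = - tau (d a).
Proof.
have [[p odd_p d_deg] _] := hd; move: a.
apply: (eq_on_homogeneous grA) => [a b|a b|k a hom_a].
- by rewrite parityD // linearD.
- by rewrite linearD parityD // opprD.
rewrite (parity_homogeneous grA hom_a) linearZ (parity_homogeneous grA (d_deg _ _ hom_a)).
by rewrite exprzDr ?unitrN1 // (sign_odd odd_p) mulrN1 scaleNr opprK.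
Qed.

Lemma wedge_biadditive : biadditive wedge.
Proof. by split=> ? ? ?; rewrite ?linearDl ?linearDr. Qed.

Lemma parity_wedge a b : tau (wedge a b) = wedge (tau a) (tau b).
Proof.
have [_ _ wedge_deg] := hA; move: a.
apply: (eq_on_homogeneous grA) => [x y|x y|k a hom_a].
- by rewrite linearDl parityD.
- by rewrite parityD // linearDl.
move: b; apply: (eq_on_homogeneous grA) => [x y|x y|l b hom_b].
- by rewrite linearDr parityD.
- by rewrite parityD // linearDr.
rewrite (parity_homogeneous grA (wedge_deg _ _ _ _ hom_a hom_b)).
rewrite (parity_homogeneous grA hom_a) (parity_homogeneous grA hom_b).
by rewrite linearZl_LR linearZr_LR scalerA exprzDr ?unitrN1.
Qed.

Lemma d_wedge a b : d (wedge a b) = wedge (d a) b + wedge (tau a) (d b).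
Proof.
move: a; apply: (eq_on_homogeneous grA) => [x y|x y|k a hom_a].
- by rewrite linearDl linearD.
- by rewrite linearD parityD // !linearDl addrACA.
move: b; apply: (eq_on_homogeneous grA) => [x y|x y|l b hom_b].
- by rewrite linearDr linearD.
- by rewrite (linearD d) !linearDr addrACA.
by rewrite (hd.2 _ _ _ _ hom_a hom_b) (parity_homogeneous grA hom_a) linearZl_LR.
Qed.

(** Up to the factor x this is (-1)^k (d a)(d b) for a of degree k, with the sign
    absorbed in tau. *)
Definition correction (x : K) (a b : A) : A := x *: wedge (d (tau a)) (d b).

Context (x : K).

Lemma correction_biadditive : biadditive (correction x).
Proof.
by split=> u v w; rewrite /correction -scalerDr ?parityD // linearD ?linearDl ?linearDr.
Qed.

Lemma correction_scale : scale_biequivariant (correction x).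
Proof.
split=> y u v; rewrite /correction ?parityZ // linearZ ?linearZl_LR ?linearZr_LR;
by rewrite !scalerA mulrC.
Qed.

(** The Leibniz rule applied to d (b c) on the left and to d (tau a tau b) on the
    right produces the same three terms; tau^2 = 1 turns tau (tau a) (d (tau b))
    into a (d (tau b)). *)
Lemma correction_cocycle a b c :
  wedge a (correction x b c) + correction x a (wedge b c) =
  wedge (correction x a b) c + correction x (wedge a b) c.
Proof.
have [_ wedgeA _] := hA.
rewrite /correction parity_wedge !d_wedge parityK.
rewrite linearDl linearDr linearZl_LR linearZr_LR !scalerDr !wedgeA /=.
by rewrite addrC addrA.
Qed.

(** Both sides are zero: d kills each d u, and also tau (d u) because d
    anticommutes with tau; hence by the Leibniz rule it kills the products of
    such elements. *)
Lemma correction_nest a b c :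
  correction x a (correction x b c) = correction x (correction x a b) c.
Proof.
have d_tau_d u : d (tau (d u)) = 0 by rewrite d_parity hd2 parity0 // oppr0.
rewrite /correction parityZ // !linearZ /= parity_wedge !d_wedge !d_tau_d !hd2.
by rewrite !(linear0l, linear0r, addr0, scaler0).
Qed.

End SuperDerivation.

(** * The deformed product *)

Lemma fps_monomialD (K : nzRingType) (V : lmodType K) n (u v : V) :
  fps_monomial n (u + v) = fps_monomial n u + fps_monomial n v.
Proof.
by apply/funext => j; rewrite !addrfctE /fps_monomial; case: ifP => _; rewrite ?addr0.
Qed.

Lemma deformed_formula_biadditive (R : realType) (A : lmodType R[i])
    (wedge : {bilinear A -> A -> A}) (d : {linear A -> A}) k l :
  biadditive (deformed_formula wedge d k l).
Proof.
split=> u v w; rewrite /deformed_formula (linearD d) ?linearDl ?linearDr scalerDr !fps_monomialD;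
  exact: addrACA.
Qed.

(** Both descriptions of the structure map A x A -> A[[hbar]] are biadditive, so it
    suffices to compare them on homogeneous elements. *)
Lemma deformed_productE (R : realType) (A : lmodType R[i])
    (gr : int -> set A) (wedge : {bilinear A -> A -> A}) (d : {linear A -> A}) :
    is_graded_algebra gr wedge ->
  deformed_product gr wedge d =
  fun f g => conv wedge f g + shift (conv (correction gr wedge d 'i%C) f g).
Proof.
move=> hA; have [grA _ _] := hA.
have wD := wedge_biadditive wedge.
have cD := correction_biadditive d hA 'i%C.
have eD := extend_homogeneous_biadditive grA (deformed_formula_biadditive wedge d).
suff ext a b : extend_homogeneous gr (deformed_formula wedge d) a b =
    fps_monomial 0 (wedge a b) + fps_monomial 1 (correction gr wedge d 'i%C a b).
  apply/funext => f; apply/funext => g; rewrite /deformed_product.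
  rewrite -cauchy_extension_monomial0 -[in RHS]cauchy_extension_monomial0.
  rewrite -cauchy_extension_monomialS -cauchy_extensionD; congr cauchy_extension.
  by apply/funext => a; apply/funext => b.
move: a; apply: (eq_on_homogeneous grA) => [x y|x y|k a hom_a].
- exact: eD.1.
- by rewrite wD.1 cD.1 !fps_monomialD; exact: addrACA.
move: b; apply: (eq_on_homogeneous grA) => [x y|x y|l b hom_b].
- exact: eD.2.
- by rewrite wD.2 cD.2 !fps_monomialD; exact: addrACA.
rewrite (extend_homogeneous_homogeneous grA (deformed_formula_biadditive wedge d) hom_a hom_b).
rewrite /deformed_formula /correction (parity_homogeneous grA hom_a) linearZ /=.
by rewrite linearZl_LR scalerA.
Qed.

Theorem proposition1p0p1 (R : realType) (A : lmodType R[i])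
    (gr : int -> set A) (wedge : {bilinear A -> A -> A}) (d : {linear A -> A})
    (hA : is_graded_algebra gr wedge)
    (hd : is_odd_superderivation gr wedge d)
    (hd2 : forall a : A, d (d a) = 0) :
  [/\ forall (k l : int) (a1 a2 : A), gr k a1 -> gr l a2 ->
        deformed_product gr wedge d (fps_monomial 0 a1) (fps_monomial 0 a2)
        = fps_monomial 0 (wedge a1 a2)
          + fps_monomial 1 (('i%C * (-1) ^ k) *: wedge (d a1) (d a2)),
      fps_bilinear (deformed_product gr wedge d),
      associative (deformed_product gr wedge d)
    & forall f g : A[[hbar]],
        deformed_product gr wedge d f g 0%N = wedge (f 0%N) (g 0%N)].
Proof.
have [grA wedgeA _] := hA.
have wD := wedge_biadditive wedge.
have cD := correction_biadditive d hA 'i%C.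
rewrite deformed_productE //; split.
- move=> k l a b hom_a _; rewrite !conv_monomial0 //; congr (_ + _).
  rewrite /correction (parity_homogeneous grA hom_a) linearZ linearZl_LR scalerA.
  by apply/funext => -[|[|n]].
- apply: two_term_deformation_bilinear => //; last exact: (correction_scale d hA).
  by split=> *; rewrite ?linearZl_LR ?linearZr_LR.
- apply: two_term_deformation_assoc => // a b c; first exact: (correction_cocycle hA hd).
  exact: (correction_nest hA hd hd2).
- by move=> f g; rewrite addrfctE /= addr0 /conv big_ord1.
Qed.
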